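(* The transformation $(X,Y,R)\mapsto\mathfrak{R}$ is a covariant functor $CoShvRep:\mathbf{Rel}\to\mathbf{CoShvAsc}$. Its restriction to $\mathbf{Rel_+}\to\mathbf{CoShvAsc}$ is a faithful covariant functor.
   Context: The category $\mathbf{Rel}$ has as objects triples $(X,Y,R)$ where $X,Y$ are sets and $R\subseteq X\times Y$. A morphism $(X,Y,R)\to(X',Y',R')$ is a pair of functions $f:X\to X'$, $g:Y\to Y'$ such that $(f(x),g(y))\in R'$ whenever $(x,y)\in R$; composition is componentwise. $\mathbf{Rel_+}$ is the full subcategory of objects $(X,Y,R)$ such that every $x\in X$ has some $y\in Y$ with $(x,y)\in R$, and every $y\in Y$ has some $x\in X$ with $(x,y)\in R$. Abstract simplicial complexes are here collections of nonempty finite sets (simplices) closed under passing to nonempty subsets; the vertices are the elements $v$ with $\{v\}$ a simplex. A simplicial map is a function on vertices sending simplices to simplices. The Dowker complex $D(X,Y,R)$ consists of the nonempty finite subsets $\sigma\subseteq X$ for which there is a $y\in Y$ with $(x,y)\in R$ for all $x\in\sigma$. For such $\sigma$, $Y_\sigma=\{y\in Y:(x,y)\in R\text{ for all }x\in\sigma\}$. For $A\subseteq X$ and $B\subseteq Y$, $R|_{A,B}=R\cap(A\times B)$, and $R^T=\{(y,x):(x,y)\in R\}$. Objects of $\mathbf{CoShvAsc}$: a cosheaf of abstract simplicial complexes $\mathfrak{C}$ on an abstract simplicial complex $K$ assigns to each simplex $\alpha$ of $K$ an abstract simplicial complex $\mathfrak{C}(\alpha)$ (costalk), and to each pair of simplices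 $\alpha\subseteq\beta$ a simplicial map $\mathfrak{C}(\alpha\subseteq\beta):\mathfrak{C}(\beta)\to\mathfrak{C}(\alpha)$ (extension) whose vertex function is an inclusion. These assignments form a contravariant functor from the face poset of $K$. Morphisms of $\mathbf{CoShvAsc}$: a morphism $m:\mathfrak{C}\to\mathfrak{D}$, with $\mathfrak{C}$ on $K$ and $\mathfrak{D}$ on $L$, along a simplicial base map $f:K\to L$ consists of simplicial maps $m_\alpha:\mathfrak{C}(\alpha)\to\mathfrak{D}(f(\alpha))$ such that $\mathfrak{D}(f(\alpha)\subseteq f(\beta))\circ m_\beta=m_\alpha\circ\mathfrak{C}(\alpha\subseteq\beta)$ for all $\alpha\subseteq\beta$. Composition is composition of base maps and components. For a relation $(X,Y,R)$, $\mathfrak{R}=CoShvRep(X,Y,R)$ is the cosheaf on $D(X,Y,R)$ with costalks $\mathfrak{R}(\sigma)=D\left(Y_\sigma,\sigma,(R|_{\sigma,Y_\sigma})^T\right)$, whose extension along $\sigma\subseteq\tau$ is the simplicial map $\mathfrak{R}(\tau)\to\mathfrak{R}(\sigma)$ along the inclusion $Y_\tau\hookrightarrow Y_\sigma$. A $\mathbf{Rel}$ morphism $(f,g):(X_1,Y_1,R_1)\to(X_2,Y_2,R_2)$ is sent to the morphism with base map the simplicial map $D(X_1,Y_1,R_1)\to D(X_2,Y_2,R_2)$ with vertex function $f$ and component at $\sigma$ the simplicial map with vertex function $g|_{(Y_1)_\sigma}:(Y_1)_\sigma\to(Y_2)_{f(\sigma)}$. *)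

(* Defs.v *)
From mathcomp Require Import all_boot.
From mathcomp Require Import boolp classical_sets functions cardinality.

Set Implicit Arguments.
Unset Strict Implicit.
Unset Printing Implicit Defensive.

Local Open Scope classical_set_scope.

Record category := Category {
  obj :> Type;
  hom : obj -> obj -> Type;
  idm : forall a, hom a a;
  compm : forall a b c, hom b c -> hom a b -> hom a c;
  compmA : forall a b c d (h : hom c d) (g : hom b c) (f : hom a b),
    compm h (compm g f) = compm (compm h g) f;
  comp1m : forall a b (f : hom a b), compm (idm b) f = f;
  compm1 : forall a b (f : hom a b), compm f (idm a) = f
}.
Arguments idm {c0} a : rename.

Record is_functor (C D : category) (F0 : C -> D)
    (F1 : forall a b : C, hom a b -> hom (F0 a) (F0 b)) : Prop := IsFunctor {
  functor_id : forall a, F1 a a (idm a) = idm (F0 a);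
  functor_comp : forall (a b c : C) (g : hom b c) (f : hom a b),
    F1 a c (compm g f) = compm (F1 b c g) (F1 a b f)
}.

Definition faithful (C D : category) (F0 : C -> D)
    (F1 : forall a b : C, hom a b -> hom (F0 a) (F0 b)) : Prop :=
  forall a b, injective (F1 a b).

Definition full_subcategory (C : category) (P : C -> Prop) : category :=
  @Category {a : C | P a} (fun a b => hom (sval a) (sval b))
    (fun a => idm (sval a)) (fun a b c g f => compm g f)
    (fun a b c d h g f => compmA h g f)
    (fun a b f => comp1m f) (fun a b f => compm1 f).

Arguments is_functor C D F0 F1 : clear implicits.
Arguments faithful C D F0 F1 : clear implicits.

Record rel_obj := RelObj {
  relX : Type;
  relY : Type;
  relR : set (relX * relY)
}.

Record rel_hom (r s : rel_obj) := RelHom {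
  homX : relX r -> relX s;
  homY : relY r -> relY s;
  homR : forall x y, relR (x, y) -> relR (homX x, homY y)
}.

Definition rel_id (r : rel_obj) : rel_hom r r :=
  @RelHom r r id id (fun x y xy => xy).

Definition rel_comp (r s t : rel_obj) (h : rel_hom s t) (k : rel_hom r s) :
    rel_hom r t :=
  @RelHom r t (homX h \o homX k) (homY h \o homY k)
    (fun x y xy => homR h (homR k xy)).

Definition Rel : category.
Proof.
by apply: (@Category rel_obj rel_hom rel_id rel_comp) => [? ? ? ? [? ? ?] [? ? ?]
  [? ? ?]|? ? [? ? ?]|? ? [? ? ?]].
Defined.

Definition rel_total (r : Rel) : Prop :=
  (forall x : relX r, exists y, relR (x, y)) /\
  (forall y : relY r, exists x, relR (x, y)).

Definition Rel_plus : category := full_subcategory rel_total.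

(** The simplices are subsets of an ambient type [V]; not every element of [V]
    needs to be a vertex. *)
Record asc (V : Type) := Asc {
  simplices : set (set V);
  simplex_finite : forall s, simplices s -> finite_set s;
  simplex_nonempty : forall s, simplices s -> s !=set0;
  simplex_face : forall s t, simplices s -> t `<=` s -> t !=set0 -> simplices t
}.

Definition vertices (V : Type) (K : asc V) : set V := [set v | simplices K [set v]].

Definition vimage (V W : Type) (K : asc V) (L : asc W)
    (f : vertices K -> vertices L) (s : set V) : set W :=
  [set \val (f v) | v in [set v : vertices K | s (\val v)]].

Record simap (V W : Type) (K : asc V) (L : asc W) := Simap {
  vfun :> vertices K -> vertices L;
  simap_simplex : forall s, simplices K s -> simplices L (vimage vfun s)
}.

Section Simap.
Context {U V W : Type}.

Lemma simap_eq (K : asc V) (L : asc W) (f g : simap K L) :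
  (forall v, \val (f v) = \val (g v)) -> f = g.
Proof.
case: f g => [f fP] [g gP] /= fg.
have e : f = g by apply/funext => v; apply/val_inj/fg.
by case: _ / e gP => gP; congr Simap; apply: Prop_irrelevance.
Qed.

Lemma vimage_id (K : asc V) (s : set V) :
  simplices K s -> vimage (@id (vertices K)) s = s.
Proof.
move=> Ks; apply/seteqP; split => [_ [v sv <-] //|x sx].
have vx : vertices K x by apply: simplex_face Ks _ _ => [_ ->//|]; exists x.
by exists (SigSub (mem_set vx)).
Qed.

Lemma vimage_comp (J : asc U) (K : asc V) (L : asc W)
    (g : vertices K -> vertices L) (f : vertices J -> vertices K) (s : set U) :
  vimage (g \o f) s = vimage g (vimage f s).
Proof.
apply/seteqP; split => [_ [v sv <-]|_ [w [v sv /val_inj vw] <-]].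
  by exists (f v) => //; exists v.
by exists v => //=; rewrite vw.
Qed.

End Simap.

Definition simap_id (V : Type) (K : asc V) : simap K K.
Proof.
by apply: (@Simap V V K K id) => s Ks; rewrite vimage_id.
Defined.

Definition simap_incl (V : Type) (K L : asc V)
  (KL : simplices K `<=` simplices L) : simap K L.
Proof.
pose f (v : vertices K) : vertices L :=
  SigSub (mem_set (KL _ (set_mem (valP v)) : vertices L (\val v))).
apply: (@Simap V V K L f) => s Ks; apply: (KL).
by have -> : vimage f s = vimage (@id (vertices K)) s by []; rewrite vimage_id.
Defined.

Definition simap_comp (U V W : Type) (J : asc U) (K : asc V) (L : asc W)
    (g : simap K L) (f : simap J K) : simap J L.
Proof.
apply: (@Simap U W J L (g \o f)) => s Js.
by rewrite vimage_comp; do 2 apply: simap_simplex.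
Defined.

Definition eq_simap (V : Type) (K L : asc V) (e : K = L) : simap K L :=
  match e in _ = L0 return simap K L0 with erefl => simap_id K end.

Lemma eq_simapE (V : Type) (K L : asc V) (e : K = L) v :
  \val (eq_simap e v) = \val v.
Proof. by case: _ / e. Qed.

Definition simap_img (V W : Type) (K : asc V) (L : asc W) (f : simap K L)
    (s : simplices K) : simplices L :=
  SigSub (mem_set (simap_simplex f (set_mem (valP s)))).

Lemma simap_imgS (V W : Type) (K : asc V) (L : asc W) (f : simap K L)
    (a b : simplices K) :
  \val a `<=` \val b -> \val (simap_img f a) `<=` \val (simap_img f b).
Proof. by move=> ab _ [v av <-]; exists v => //; apply: ab. Qed.

Lemma simap_img_id (V : Type) (K : asc V) (a : simplices K) :
  simap_img (simap_id K) a = a.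
Proof. by apply/val_inj/vimage_id/set_mem/valP. Qed.

Lemma simap_img_comp (U V W : Type) (J : asc U) (K : asc V) (L : asc W)
    (g : simap K L) (f : simap J K) (a : simplices J) :
  simap_img (simap_comp g f) a = simap_img g (simap_img f a).
Proof. by apply/val_inj/vimage_comp. Qed.

Arguments simap_imgS {V W K L} f {a b} ab.

(** All costalks of a cosheaf live in one ambient type, so that extensions can be literal
    inclusions of vertex sets. *)
Record cosheaf := Cosheaf {
  base_pt : Type;
  base : asc base_pt;
  costalk_pt : Type;
  costalk : simplices base -> asc costalk_pt;
  ext : forall a b : simplices base, \val a `<=` \val b ->
    simap (costalk b) (costalk a);
  ext_incl : forall a b (ab : \val a `<=` \val b) v, \val (ext ab v) = \val v;
  ext_id : forall a (aa : \val a `<=` \val a), ext aa = simap_id (costalk a);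
  ext_comp : forall a b c (ab : \val a `<=` \val b) (bc : \val b `<=` \val c)
    (ac : \val a `<=` \val c), ext ac = simap_comp (ext ab) (ext bc)
}.

Record cosheaf_hom (C D : cosheaf) := CosheafHom {
  bmap : simap (base C) (base D);
  cmap : forall a, simap (costalk a) (costalk (simap_img bmap a));
  cmap_ext : forall (a b : simplices (base C)) (ab : \val a `<=` \val b),
    simap_comp (ext (simap_imgS bmap ab)) (cmap b) =
    simap_comp (cmap a) (ext ab)
}.
Arguments cmap {C D} m a : rename.

Lemma cosheaf_hom_eq (C D : cosheaf) (m n : cosheaf_hom C D) :
  (forall v, \val (bmap m v) = \val (bmap n v)) ->
  (forall a v, \val (cmap m a v) = \val (cmap n a v)) -> m = n.
Proof.
case: m n => [f m mP] [g n nP] /= /simap_eq fg; move: n nP.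
case: _ / fg => n nP mn.
have e : m = n.
  by apply: boolp.functional_extensionality_dep => a; apply: simap_eq; apply: mn.
by case: _ / e nP {mn} => nP; rewrite (Prop_irrelevance mP nP).
Qed.

Lemma cmap_val (C D : cosheaf) (m : cosheaf_hom C D)
    (a b : simplices (base C))    (ab : \val a `<=` \val b) v : \val (cmap m b v) = \val (cmap m a (ext ab v)).
Proof.
have /(congr1 (fun f : simap _ _ => \val (f v))) /= := cmap_ext m ab.
by rewrite ext_incl.
Qed.

(** [simap_img] preserves identities and composites only propositionally;
    [eq_simap] identifies the corresponding equal costalks. *)
Definition cosheaf_id (C : cosheaf) : cosheaf_hom C C.
Proof.
apply: (@CosheafHom C C (simap_id (base C))
  (fun a => eq_simap (congr1 (@costalk C) (esym (simap_img_id a))))) => a b ab.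
by apply: simap_eq => v /=; rewrite ext_incl !eq_simapE ext_incl.
Defined.

Definition cosheaf_comp (C D E : cosheaf) (n : cosheaf_hom D E)
    (m : cosheaf_hom C D) : cosheaf_hom C E.
Proof.
apply: (@CosheafHom C E (simap_comp (bmap n) (bmap m))
  (fun a => simap_comp
    (eq_simap (congr1 (@costalk E) (esym (simap_img_comp (bmap n) (bmap m) a))))
    (simap_comp (cmap n (simap_img (bmap m) a)) (cmap m a)))) => a b ab.
apply: simap_eq => v /=; rewrite ext_incl !eq_simapE.
rewrite (cmap_val n (simap_imgS (bmap m) ab)); congr (\val (cmap n _ _)).
by apply: val_inj; rewrite ext_incl (cmap_val m ab).
Defined.

Definition CoShvAsc : category.
Proof.
apply: (@Category cosheaf cosheaf_hom cosheaf_id cosheaf_comp)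
  => [A B C D h g f|C D f|C D f]; apply: cosheaf_hom_eq => //= a v;
  rewrite !eq_simapE //=.
- have ha : \val (simap_img (bmap g) (simap_img (bmap f) a)) `<=`
      \val (simap_img (simap_comp (bmap g) (bmap f)) a).
    by rewrite simap_img_comp.
  rewrite (cmap_val h ha); congr (\val (cmap h _ _)).
  by apply/val_inj; rewrite ext_incl eq_simapE.
- have ha : \val a `<=` \val (simap_img (simap_id (base C)) a).
    by rewrite simap_img_id.
  rewrite (cmap_val f ha); congr (\val (cmap f _ _)).
  by apply/val_inj; rewrite ext_incl eq_simapE.
Defined.

Definition dowker (X Y : Type) (A : set X) (B : set Y) (R : set (X * Y)) : asc X.
Proof.
apply: (@Asc X [set s | [/\ finite_set s, s !=set0, s `<=` A &
  exists2 y, B y & forall x, s x -> R (x, y)]]).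
- by move=> s [].
- by move=> s [].
- move=> s t [fs _ sA [y By sR]] ts t0; split => //.
  + exact: sub_finite_set ts fs.
  + exact: subset_trans ts sA.
  + by exists y => // x /ts/sR.
Defined.

Definition rel_dowker (r : rel_obj) : asc (relX r) :=
  dowker [set: relX r] [set: relY r] (@relR r).

Definition witnesses (r : rel_obj) (s : set (relX r)) : set (relY r) :=
  [set y | forall x, s x -> relR (x, y)].

Definition restrict_rel (X Y : Type) (A : set X) (B : set Y) (R : set (X * Y)) :
  set (X * Y) := R `&` (A `*` B).

Definition rep_costalk (r : rel_obj) (s : set (relX r)) : asc (relY r) :=
  dowker (witnesses s) s ((restrict_rel s (witnesses s) (@relR r))^-1)%relation.

Lemma rep_costalkS (r : rel_obj) (s t : set (relX r)) :
  s `<=` t -> s !=set0 ->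
  simplices (rep_costalk t) `<=` simplices (rep_costalk s).
Proof.
move=> st [x sx] u /= [fu u0 ut _].
have us : u `<=` witnesses s by move=> y /ut uy z /st/uy.
by split => //; exists x => // y uy; split; [exact: us|split => //; exact: us].
Qed.

Definition rep_ext (r : rel_obj) (a b : simplices (rel_dowker r))
    (ab : \val a `<=` \val b) :
    simap (rep_costalk (\val b)) (rep_costalk (\val a)) :=
  simap_incl (rep_costalkS ab (simplex_nonempty (set_mem (valP a)))).

Definition CoShvRep (r : Rel) : CoShvAsc.
Proof.
apply: (@Cosheaf (relX r) (rel_dowker r) (relY r)
  (fun a => rep_costalk (\val a)) (@rep_ext r)) => // *; exact: simap_eq.
Defined.

(** This determines [m] uniquely, by [cosheaf_hom_eq]. *)
Definition is_CoShvRep_hom (r s : Rel) (h : hom r s)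
    (m : hom (CoShvRep r : CoShvAsc) (CoShvRep s : CoShvAsc)) : Prop :=
  (forall v : vertices (rel_dowker r), \val (bmap m v) = homX h (\val v)) /\
  (forall (a : simplices (rel_dowker r)) (v : vertices (rep_costalk (\val a))),
     \val (cmap m a v) = homY h (\val v)).
Arguments is_CoShvRep_hom r s h m : clear implicits.

(* Main.v *)
(** The representation of [(f, g)] is well defined because [f] maps [sigma] to [f(sigma)] and [g]
    maps common witnesses of [sigma] to common witnesses of [f(sigma)].  On [Rel_plus] it
    determines [f] because every [x] is a vertex of the Dowker complex, and it determines
    [g] because every [y] is related to some [x], hence is a vertex of the costalk at [{x}]. *)
Require Import Defs.
From mathcomp Require Import all_boot.
From mathcomp Require Import boolp classical_sets cardinality.

Set Implicit Arguments.
Unset Strict Implicit.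
Unset Printing Implicit Defensive.

Local Open Scope classical_set_scope.

Section SimapOfFun.
Context {V W : Type} (K : asc V) (L : asc W) (f : V -> W)
  (f_simplex : forall s, simplices K s -> simplices L (f @` s)).

(** [vimage] sees only those elements of [s] that are vertices of [K]. Closure under nonempty
    subsets makes every element of a simplex a vertex, so no point of the image is lost. *)
Lemma vimage_image (g : vertices K -> vertices L) (s : set V) :
  (forall v, \val (g v) = f (\val v)) -> simplices K s -> vimage g s = f @` s.
Proof.
move=> gf Ks; rewrite -[in RHS](vimage_id Ks) /vimage image_comp.
by apply: eq_imagel => v _; rewrite gf.
Qed.

Lemma vertices_image (v : vertices K) : vertices L (f (\val v)).
Proof. by rewrite /vertices /= -image_set1; apply/f_simplex/(set_mem (valP v)). Qed.

Definition simap_of_fun : simap K L.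
Proof.
apply: (@Simap V W K L (fun v => SigSub (mem_set (vertices_image v)))) => s Ks.
by rewrite vimage_image //; apply: f_simplex.
Defined.

Lemma simap_of_fun_img (a : simplices K) :
  \val (simap_img simap_of_fun a) = f @` \val a.
Proof. by apply: vimage_image => //; apply/set_mem/valP. Qed.

End SimapOfFun.

Lemma rel_dowkerE (r : rel_obj) (s : set (relX r)) :
  simplices (rel_dowker r) s <->
  [/\ finite_set s, s !=set0 & witnesses s !=set0].
Proof.
by split=> [[fs s0 _ [y _ ys]]|[fs s0 [y ys]]]; split => //; exists y.
Qed.

(** Each element of [s] is related to all of [witnesses s], so any single one certifies [u] as a
    simplex: the costalk is the full simplex on [witnesses s]. *)
Lemma rep_costalkE (r : rel_obj) (s : set (relX r)) (u : set (relY r)) :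
  s !=set0 ->
  simplices (rep_costalk s) u <->
  [/\ finite_set u, u !=set0 & u `<=` witnesses s].
Proof.
move=> [x sx]; split=> [[fu u0 us _]|[fu u0 us]]; split => //.
by exists x => // y uy; split; [exact: us|split => //; exact: us].
Qed.

Lemma rel_hom_eq (r s : rel_obj) (h k : rel_hom r s) :
  homX h =1 homX k -> homY h =1 homY k -> h = k.
Proof.
case: h k => [f g fg] [f' g' fg'] /= /funext ff' /funext gg'.
by case: _ / ff' fg'; case: _ / gg' => fg'; congr RelHom; apply: Prop_irrelevance.
Qed.

Section Rep.
Context {r s : rel_obj} (h : rel_hom r s).

Lemma homY_witnesses (a : set (relX r)) :
  homY h @` witnesses a `<=` witnesses (homX h @` a).
Proof. by move=> _ [y ya <-] _ [x ax <-]; apply/homR/ya. Qed.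

Lemma homX_simplex (a : set (relX r)) :
  simplices (rel_dowker r) a -> simplices (rel_dowker s) (homX h @` a).
Proof.
move=> /rel_dowkerE[fa a0 [y ya]]; apply/rel_dowkerE; split.
- exact: finite_image.
- exact: image_nonempty.
- by exists (homY h y); apply: homY_witnesses; exists y.
Qed.

Definition rep_bmap : simap (rel_dowker r) (rel_dowker s) :=
  simap_of_fun homX_simplex.

Lemma homY_simplex (a : simplices (rel_dowker r)) (u : set (relY r)) :
  simplices (rep_costalk (\val a)) u ->
  simplices (rep_costalk (\val (simap_img rep_bmap a))) (homY h @` u).
Proof.
have a0 : \val a !=set0 := simplex_nonempty (set_mem (valP a)).
move=> /(rep_costalkE _ a0)[fu u0 ua].
(* The base simplex is a [vimage] over vertices; it must become the direct image under [homX h]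
   before [homY_witnesses] can apply. *)
rewrite simap_of_fun_img; apply/rep_costalkE; first exact: image_nonempty.
split; [exact: finite_image|exact: image_nonempty|].
by apply: subset_trans (@homY_witnesses _); apply: image_subset.
Qed.

Definition rep_hom :
  cosheaf_hom (CoShvRep (r : Rel) : CoShvAsc) (CoShvRep (s : Rel) : CoShvAsc).
Proof.
apply: (@CosheafHom (CoShvRep r) (CoShvRep s) rep_bmap
  (fun a => simap_of_fun (@homY_simplex a))) => a b ab.
(* Extensions are inclusions and both components act by [homY h], so the two sides of the square
   agree on underlying elements. *)
exact: simap_eq.
Defined.

End Rep.

Lemma rep_homP (r s : Rel) (h : hom r s) : is_CoShvRep_hom r s h (rep_hom h).
Proof. by []. Qed.

Lemma rep_hom_functor : is_functor Rel CoShvAsc CoShvRep (fun r s h => rep_hom h).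
Proof.
(* Morphisms are compared on underlying elements, where the transport [eq_simap] acts as the
   identity. *)
by split=> [r|r s t k h]; apply: cosheaf_hom_eq => // a v; rewrite /= eq_simapE.
Qed.

Lemma rep_hom_inj (r s : Rel) : rel_total r -> injective (@rep_hom r s).
Proof.
move=> [totX totY] h k hk.
have vX x : vertices (rel_dowker r) x.
  have [y xy] := totX x; apply/rel_dowkerE; split => //; first by exists x.
  by exists y => _ ->.
apply: rel_hom_eq => [x|y].
  (* Rewriting with [hk] makes one morphism satisfy the specifications of both [h] and [k]; its
     value at the vertex [x] is then computed in two ways. *)
  have := rep_homP h; rewrite hk => -[/(_ (SigSub (mem_set (vX x)))) <- _].
  by rewrite (rep_homP k).1.
have [x xy] := totY y.
pose a : simplices (rel_dowker r) :=
  SigSub (mem_set (vX x : simplices (rel_dowker r) [set x])).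
have ya : vertices (rep_costalk (\val a)) y.
  apply/rep_costalkE; first by exists x.
  by split => //; [exists y|move=> _ -> _ ->].
have := rep_homP h; rewrite hk => -[_ /(_ a (SigSub (mem_set ya))) <-].
by rewrite (rep_homP k).2.
Qed.

Theorem corollary4 :
  exists CoShvRep1 : forall r s : Rel,
      hom r s -> hom (CoShvRep r : CoShvAsc) (CoShvRep s : CoShvAsc),
  [/\ forall (r s : Rel) (h : hom r s), is_CoShvRep_hom r s h (CoShvRep1 r s h),
      is_functor Rel CoShvAsc CoShvRep CoShvRep1,
      is_functor Rel_plus CoShvAsc (fun r => CoShvRep (sval r))
        (fun r s h => CoShvRep1 (sval r) (sval s) h) &
      faithful Rel_plus CoShvAsc (fun r => CoShvRep (sval r))
        (fun r s h => CoShvRep1 (sval r) (sval s) h)].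
Proof.
exists (fun r s h => rep_hom h); have [F1 FM] := rep_hom_functor.
split; [exact: rep_homP|exact: rep_hom_functor| |].
(* Identities and composites in a full subcategory are by definition those of the ambient
   category. *)
- by split=> [r|r s t k h]; [exact: F1|exact: FM].
- by move=> r s; apply: rep_hom_inj (svalP r).
Qed.
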